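(* Let $T \in \mathbf{B}(\mathcal H)$. If $T$ is compact, then $T$ is not subspace-hypercyclic for any nonzero subspace of $\mathcal H$.
   Context: $\mathcal H$ is a separable Hilbert space over $\mathbb C$; $\mathbf{B}(\mathcal H)$ is the set of bounded linear operators on $\mathcal H$; ''subspace'' always means topologically closed linear subspace; $\mathbb N_0 = \mathbb N\cup\{0\}$. For $x\in\mathcal H$, $\operatorname{Orb}(T,x) := \{T^n x : n\in\mathbb N_0\}$. $T$ is subspace-hypercyclic for a nonzero subspace $\mathcal M$ if there exists $x\in\mathcal H$ such that $\operatorname{Orb}(T,x)\cap\mathcal M$ is dense in $\mathcal M$. *)

(* Defs.v *)
From HB Require Import structures.
From mathcomp Require Import all_boot all_order all_algebra.
From mathcomp Require Import complex.
From mathcomp Require Import all_classical all_reals all_analysis.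

Set Implicit Arguments.
Unset Strict Implicit.
Unset Printing Implicit Defensive.

Import Order.TTheory GRing.Theory Num.Theory.
Import numFieldNormedType.Exports.

Local Open Scope classical_set_scope.
Local Open Scope ring_scope.

(* The inner product is linear in the first argument, conjugate-linear in the
   second; requiring it to induce the norm, hence the topology, of H makes the
   completeness of H that of the inner product space. *)
HB.mixin Record CompleteNormedModule_isHilbert (R : realType) H
    of CompleteNormedModule R[i] H := {
  inner : {dot H for Num.conj};
  innerE : forall x : H, inner x x = `|x| ^+ 2
}.

#[short(type="hilbertType")]
HB.structure Definition Hilbert (R : realType) :=
  { H of CompleteNormedModule R[i] H & CompleteNormedModule_isHilbert R H }.

Definition separable (T : topologicalType) :=
  exists2 A : set T, countable A & dense A.

Section operators.
Context {R : realType} {H : hilbertType R}.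
Implicit Types (T : {linear H -> H}) (M : set H) (x : H).

Definition closed_subspace M :=
  [/\ M 0, forall (a : R[i]) u v, M u -> M v -> M (a *: u + v) & closed M].

Definition bounded_operator T := bounded_near T (nbhs (0 : H)).

Definition compact_operator T :=
  forall A : set H, bounded_set A -> precompact (T @` A).

Definition Orb T x : set H := range (fun n => iter n T x).

Definition subspace_hypercyclic T M :=
  exists x, M `<=` closure (Orb T x `&` M).

End operators.

(* Main.v *)
Require Import Defs.
From mathcomp Require Import all_boot all_order all_algebra.
From mathcomp Require Import complex.
From mathcomp Require Import all_classical all_reals all_analysis.
From mathcomp Require Import zify.

(**
Suppose [iter n T x] accumulates at every point of the nonzero subspace [M]:
the orbit comes arbitrarily close to 0 infinitely often, and it is unbounded.
Let [X] be the smallest closed subspace containing the orbit, and let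
[lambda] be unimodular. Modulo the closure [Y] of the range of [T - lambda] on
[X], [iter n T x] is [lambda ^+ n *: x], which stays away from 0 unless [x] is
in [Y], and hence [Y = X]. As [T] is compact, the Riesz-Schauder arguments give
that [T - lambda] is injective on [X], and then that it is bounded below on [X]
uniformly in [lambda]. The vectors
[y = \sum_(m < N) c ^+ m.+1 *: iter m T x] satisfy
[T y - c^-1 *: y = c ^+ N *: iter N T x - x], so they are bounded by a multiple
of [`|x| + `|iter N T x|] for unimodular [c]; averaging over roots of unity, so
is every [iter n T x] with [n < N]. Letting [N] run through times at which
[iter N T x] is small shows that the orbit is bounded, a contradiction.
*)

Set Implicit Arguments.
Unset Strict Implicit.
Unset Printing Implicit Defensive.

Import Order.TTheory GRing.Theory Num.Theory.
Import numFieldNormedType.Exports.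

Local Open Scope classical_set_scope.
Local Open Scope ring_scope.

(** * Limits and distances in normed spaces over [R[i]] *)

Section complex_normed.
Context {R : realType}.
Local Notation C := R[i].

(** A positive element of [R[i]] is real, so this reduces to the Archimedean property of [R]. *)
Lemma near_natSinv_lt (eps : C) : 0 < eps ->
  \forall n \near \oo, n.+1%:R^-1 < eps.
Proof.
move=> eps0; have eps_real : eps \is Num.real by rewrite realE ltW.
have Re_gt0 : 0 < complex.Re eps by move: eps0; rewrite ltcE => /andP[].
near=> n.
rewrite -[eps]RRe_real // -(rmorph_nat (@real_complex R)) -fmorphV ltcR.
by near: n; exact: (near_infty_natSinv_lt (PosNum Re_gt0)).
Unshelve. all: by end_near. Qed.

Context {V : normedModType C}.
Implicit Types (u : nat -> V).

Lemma cvg0_natSinv u : (forall n, `|u n| <= n.+1%:R^-1) -> u n @[n --> \oo] --> 0.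
Proof.
move=> hu; apply/cvgrPdist_lt => eps eps0; near=> n.
rewrite sub0r normrN; apply: le_lt_trans (hu n) _.
by near: n; exact: near_natSinv_lt.
Unshelve. all: by end_near. Qed.

Lemma cvg_natSinv u (l : V) : (forall n, `|u n - l| <= n.+1%:R^-1) ->
  u n @[n --> \oo] --> l.
Proof. by move=> hu; apply/subr_cvg0; exact: cvg0_natSinv. Qed.

Lemma cvg_eqfun u u' (l : V) : (forall n, u n = u' n) ->
  u n @[n --> \oo] --> l -> u' n @[n --> \oo] --> l.
Proof. by move=> /funext ->. Qed.

(** Subsequences are encoded below by index maps with [n <= e n], not necessarily monotone; this is
    what lets limits pass to them. *)
Lemma cvg_ge_id (e : nat -> nat) :
  (forall n, (n <= e n)%N) -> e n @[n --> \oo] --> \oo.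
Proof.
move=> he A [N _ NA]; exists N => // n /= Nn; apply: NA => /=.
exact: leq_trans (he n).
Qed.

Lemma cvg_limit_eq u (l l' : V) :
  u n @[n --> \oo] --> l -> u n @[n --> \oo] --> l' -> l = l'.
Proof. by move=> hl hl'; apply: (cvg_unique _ hl hl'); exact: norm_hausdorff. Qed.

Lemma closure_seq (A : set V) p : closure A p ->
  exists u, (forall n, A (u n)) /\ u n @[n --> \oo] --> p.
Proof.
move=> Ap; have /choice[u hu] : forall n, exists a, A a /\ `|a - p| <= n.+1%:R^-1.
  move=> n; have [] := Ap (ball p n.+1%:R^-1).
    by apply: (nbhsx_ballx p); rewrite invr_gt0 ltr0n.
  move=> a [Aa]; rewrite -ball_normE /= => /ltW pa; exists a; split => //.
  by rewrite distrC.
exists u; split => [n|]; first by have [] := hu n.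
by apply: cvg_natSinv => n; have [] := hu n.
Qed.

Lemma notin_closed_dist (A : set V) p : closed A -> ~ A p ->
  exists2 d, 0 < d & forall a, A a -> d <= `|p - a|.
Proof.
move=> cA nAp; have : nbhs p (~` A).
  by apply: open_nbhs_nbhs; split => //; exact: closed_openC.
move=> /nbhs_ballP[d /= d0 dA]; exists d => // a Aa.
rewrite real_leNgt ?normr_real ?gtr0_real //; apply/negP => pad.
by apply: (dA a) Aa; rewrite -ball_normE.
Qed.

End complex_normed.

(** * Closed subspaces and nearly best approximation *)

Section subspaces.
Context {R : realType} {H : hilbertType R}.
Local Notation C := R[i].
Implicit Types (X N : set H) (u v x : H) (a lambda : C).

Lemma closed_subspace0 X : closed_subspace X -> X 0.
Proof. by case. Qed.

Lemma closed_subspace_lin X a u v : closed_subspace X -> X u -> X v -> X (a *: u + v).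
Proof. by case=> _ + _; apply. Qed.

Lemma closed_subspaceZ X a u : closed_subspace X -> X u -> X (a *: u).
Proof.
by move=> sX Xu; rewrite -[_ *: _]addr0; apply: closed_subspace_lin => //; case: sX.
Qed.

Lemma closed_subspaceD X u v : closed_subspace X -> X u -> X v -> X (u + v).
Proof. by move=> sX Xu Xv; rewrite -[u]scale1r; exact: closed_subspace_lin. Qed.

Lemma closed_subspaceB X u v : closed_subspace X -> X u -> X v -> X (u - v).
Proof.
by move=> sX Xu Xv; rewrite -scaleN1r addrC; exact: closed_subspace_lin.
Qed.

Lemma closed_subspace_sum X (I : finType) (F : I -> H) : closed_subspace X ->
  (forall i, X (F i)) -> X (\sum_i F i).
Proof.
move=> sX XF; elim/big_ind: _ => //; first by case: sX.
by move=> u v; exact: closed_subspaceD.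
Qed.

Lemma closed_subspace_cvg X (w : nat -> H) p : closed_subspace X ->
  (forall n, X (w n)) -> w n @[n --> \oo] --> p -> X p.
Proof.
by move=> [_ _ cX] Xw; apply: (closed_cvg X cX); exact: nearW.
Qed.

Lemma closed_subspace_closure (A : set H) : A 0 ->
  (forall a u v, A u -> A v -> A (a *: u + v)) -> closed_subspace (closure A).
Proof.
move=> A0 AL; split; [exact: subset_closure | | exact: closed_closure].
move=> a u v /closure_seq[s [As su]] /closure_seq[t [At tv]].
have : (a *: s n + t n) @[n --> \oo] --> a *: u + v.
  by apply: cvgD tv; exact: cvgZr.
apply: (closed_cvg _ (@closed_closure _ A)).
by apply: nearW => n; apply: subset_closure; exact: AL.
Qed.

(** Otherwise every [m] in [X] could be replaced by one at less than half its distance to [u].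
    Iterating from 0 would bring points of [X] arbitrarily close to [u], although [u] lies at a
    positive distance [d] from [X]. *)
Lemma near_best_approx X u : closed_subspace X ->
  exists2 m, X m & forall v, X v -> `|u - m| <= 2 * `|u - v|.
Proof.
move=> sX; have [Xu|nXu] := pselect (X u).
  by exists u => // v Xv; rewrite subrr normr0 mulr_ge0.
have [_ _ cX] := sX.
have [d d0 dX] := notin_closed_dist cX nXu.
apply: contrapT => no_m.
have /choice[f fP] : forall m, exists m', X m -> X m' /\ 2 * `|u - m'| < `|u - m|.
  move=> m; have [Xm|nXm] := pselect (X m); last by exists 0.
  apply: contrapT => nm; apply: no_m; exists m => // v Xv.
  rewrite real_leNgt ?realM ?normr_real //; apply/negP => lt.
  by apply: nm; exists v.
have Xf n : X (iter n f 0).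
  by elim: n => [|n IHn] /=; [case: sX | have [] := fP _ IHn].
have le n : 2 ^+ n * d <= `|u|.
  apply: (@le_trans _ _ (2 ^+ n * `|u - iter n f 0|)).
    by rewrite ler_pM2l ?exprn_gt0 //; exact: dX.
  elim: n => [|n IHn]; first by rewrite expr0 mul1r subr0.
  apply: le_trans IHn; rewrite exprSr -mulrA ler_pM2l ?exprn_gt0 //.
  by have [_ /ltW] := fP _ (Xf n).
have u0 : 0 < `|u| by apply: lt_le_trans (le 0%N); rewrite mul1r.
(* Some [n] satisfies [|u| < d * n.+1], while [n.+1 <= 2 ^ n] and [2 ^ n * d <= |u|]. *)
have [] := @near_natSinv_lt R (d / `|u|); first by rewrite divr_gt0.
move=> n _ /(_ n (leqnn n)) /=.
rewrite ltr_pdivlMr // mulrC ltr_pdivrMr ?ltr0n // => lt_u.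
suff : d * n.+1%:R <= `|u| by move=> /(lt_le_trans lt_u); rewrite ltxx.
apply: le_trans (le n).
by rewrite mulrC ler_pM2r // -natrX ler_nat ltn_expl.
Qed.
End subspaces.

(** * Convergent subsequences and approximate eigenvectors of a compact operator *)

Section compact_operators.
Context {R : realType} {H : hilbertType R} (T : {linear H -> H}).
Hypotheses (T_bounded : bounded_operator T) (T_compact : compact_operator T).
Local Notation C := R[i].
Implicit Types (X N : set H) (u v x : H) (a lambda : C).

Lemma operator_cvg (w : nat -> H) p :
  w n @[n --> \oo] --> p -> T (w n) @[n --> \oo] --> T p.
Proof.
by move=> wp; apply: continuous_cvg wp; exact: bounded_linear_continuous.
Qed.

Lemma closed_subspace_preimage X : closed_subspace X -> closed_subspace (T @^-1` X).
Proof.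
move=> sX; split => /=; [by rewrite linear0; case: sX | | ].
  move=> a u v Xu Xv; rewrite /preimage /= linearP; exact: closed_subspace_lin.
have [_ _ cX] := sX; apply: preimage_closed cX => u _.
exact: bounded_linear_continuous.
Qed.

Lemma compact_operator_subseq (v : nat -> H) (b : C) : (forall n, `|v n| <= b) ->
  exists (e : nat -> nat) (p : H),
    (forall n, (n <= e n)%N) /\ T (v (e n)) @[n --> \oo] --> p.
Proof.
move=> vb; have bv : bounded_set (range v).
  exists b; split; first by rewrite ger0_real // (le_trans _ (vb 0%N)).
  by move=> M /ltW bM _ [n _ <-] /=; exact: le_trans (vb n) bM.
have := T_compact bv; rewrite precompactE => cK.
have [|p [_ clp]] := cK ((T \o v) @ \oo) _.
  exists 0%N => // n _ /=; apply: subset_closure.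
  by exists (v n) => //; exists n.
have /choice[e eP] : forall n, exists m, (n <= m)%N /\ `|T (v m) - p| <= n.+1%:R^-1.
  move=> n; have [] := clp ((T \o v) @` [set m | (n <= m)%N]) (ball p n.+1%:R^-1).
  - by exists n => // m /= nm; exists m.
  - by apply: (nbhsx_ballx p); rewrite invr_gt0 ltr0n.
  move=> _ [[m /= nm <-]]; rewrite -ball_normE /= distrC => /ltW.
  by exists m.
exists e, p; split => [n|]; first by have [] := eP n.
by apply: cvg_natSinv => n; have [] := eP n.
Qed.

(** When the bound [n.+1] fails for each [n], normalising the witnesses gives unit vectors [w n]
    with [T (w n) - l n *: w n] tending to 0. By compactness [T (w n)] tends to some [p] along a
    subsequence, hence so does [l n *: w n]; applying [T] to the latter gives the limit of
    [l n *: p]. The predicate [P] serves both for a fixed [lambda] and for all unimodular ones at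
    once. *)
Lemma bounded_below_or_approx_eigen (P : C -> set H) :
    (forall lambda u, P lambda u -> `|lambda| = 1) ->
    (forall lambda a u, P lambda u -> P lambda (a *: u)) ->
  (exists2 b, 0 <= b &
     forall lambda u, P lambda u -> `|u| <= b * `|T u - lambda *: u|) \/
  exists (l : nat -> C) (w : nat -> H) (p : H), [/\ forall n, P (l n) (w n),
    forall n, `|w n| = 1, l n *: w n @[n --> \oo] --> p &
    l n *: p @[n --> \oo] --> T p].
Proof.
move=> P1 PZ; apply: contrapT => /not_orP[nb na]; apply: na.
have /choice[s sP] : forall n, exists s : C * H, [/\ P s.1 s.2, `|s.2| = 1 &
    `|s.1 *: s.2 - T s.2| <= n.+1%:R^-1].
  move=> n; apply: contrapT => ns; apply: nb; exists n.+1%:R => // lambda u Pu.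
  rewrite real_leNgt ?realM ?normr_real ?realn //; apply/negP => lt_u.
  have u0 : 0 < `|u| by apply: le_lt_trans lt_u; rewrite mulr_ge0.
  have nu0 : 0 <= `|u|^-1 by rewrite invr_ge0.
  apply: ns; exists (lambda, `|u|^-1 *: u); split => /=.
  - exact: PZ.
  - by rewrite normrZ ger0_norm // mulVf // gt_eqF.
  rewrite [T _]linearZ /= scalerA mulrC -scalerA -scalerBr normrZ.
  rewrite ger0_norm // distrC.
  by rewrite ler_pdivrMl // ler_pdivlMr ?ltr0n // mulrC ltW.
have w1 n : `|(s n).2| = 1 by have [] := sP n.
have [e [p [e_ge Tp]]] : exists (e : nat -> nat) (p : H),
    (forall n, (n <= e n)%N) /\ T (s (e n)).2 @[n --> \oo] --> p.
  by apply: (@compact_operator_subseq (snd \o s) 1) => n /=; rewrite w1.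
have lp : (s (e n)).1 *: (s (e n)).2 @[n --> \oo] --> p.
  have d0 : ((s (e n)).1 *: (s (e n)).2 - T (s (e n)).2) @[n --> \oo] --> (0 : H).
    have := cvg0_natSinv (u := fun n => (s n).1 *: (s n).2 - T (s n).2).
    move=> /(_ _)/(cvg_comp e _ (cvg_ge_id e_ge)); apply => n.
    by have [] := sP n.
  rewrite -[p]add0r; apply: cvg_eqfun (cvgD d0 Tp) => n /=.
  by rewrite subrK.
exists (fun n => (s (e n)).1), (fun n => (s (e n)).2), p; split => //.
  by move=> n; have [] := sP (e n).
have l1 n : `|(s (e n)).1| = 1 by have [/P1] := sP (e n).
have : (s (e n)).1 *: (T (s (e n)).2 - p) @[n --> \oo] --> (0 : H).
  apply: norm_cvg0; under eq_fun do rewrite normrZ l1 mul1r.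
  by apply/norm_cvg0P; exact/subr_cvg0.
move=> /(cvgB (operator_cvg lp)); rewrite subr0; apply: cvg_eqfun => n /=.
by rewrite !fctE [T (_ *: _)]linearZ /= scalerBr subKr.
Qed.

End compact_operators.

(** * Riesz-Schauder arguments for [T - lambda] on an invariant closed subspace *)

Section fredholm.
Context {R : realType} {H : hilbertType R} (T : {linear H -> H}).
Hypotheses (T_bounded : bounded_operator T) (T_compact : compact_operator T).
Local Notation C := R[i].
Context (X : set H) (lambda : C).
Hypotheses (X_sub : closed_subspace X) (TX : forall u, X u -> X (T u)).
Hypothesis lambda1 : `|lambda| = 1.
Implicit Types (u v x : H) (a : C).

Let A u := T u - lambda *: u.

Let A_lin a u v : A (a *: u + v) = a *: A u + A v.
Proof.
by rewrite /A linearP scalerDr scalerBr !scalerA mulrC opprD addrACA.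
Qed.

Let A_cvg (w : nat -> H) p : w n @[n --> \oo] --> p -> A (w n) @[n --> \oo] --> A p.
Proof. by move=> wp; apply: cvgB; [exact: operator_cvg | exact: cvgZr]. Qed.

Let lambda0 : lambda != 0.
Proof. by rewrite -normr_gt0 lambda1. Qed.

Let iterA_kernel k : closed_subspace (X `&` [set u | iter k A u = 0]).
Proof.
have lin a u v : iter k A (a *: u + v) = a *: iter k A u + iter k A v.
  by elim: k => //= k ->.
have cvg (w : nat -> H) p :
    w n @[n --> \oo] --> p -> iter k A (w n) @[n --> \oo] --> iter k A p.
  by elim: k {lin} => //= k IH wp; apply: A_cvg; exact: IH.
split => /=.
- split; first exact: closed_subspace0.
  by rewrite -[0 in LHS](subrr 0) -scaleN1r addrC lin scaleN1r addNr.
- move=> a u v [Xu Au] [Xv Av]; split; first exact: closed_subspace_lin.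
  by rewrite /= lin Au Av scaler0 addr0.
- rewrite closure_id; apply/seteqP; split=> [|p]; first exact: subset_closure.
  move=> /closure_seq[w [Kw wp]]; split.
    by apply: closed_subspace_cvg wp => // n; have [] := Kw n.
  apply: (cvg_limit_eq (cvg _ _ wp)).
  by under eq_fun do rewrite (Kw _).2; exact: cvg_cst.
Qed.

(** The range of [A] is closed: up to the kernel [K], preimages of a convergent sequence can be
    chosen bounded, and compactness then makes a subsequence of them converge. *)
Lemma dense_range_onto : X `<=` closure [set T u - lambda *: u | u in X] ->
  forall y, X y -> exists2 u, X u & T u - lambda *: u = y.
Proof.
move=> dX y Xy.
have sK := iterA_kernel 1; set K := (X `&` _) in sK.
(* These vectors are almost shortest in their coset modulo [K]. They do not form a subspace, but
   they are stable under scaling. *)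
pose P l u := [/\ l = lambda, X u & forall k, K k -> `|u| <= 2 * `|u - k|].
have P1 l u : P l u -> `|l| = 1 by move=> [->].
have PZ l a u : P l u -> P l (a *: u).
  move=> [-> Xu uK]; split => //; first exact: closed_subspaceZ.
  move=> k Kk; have [->|a0] := eqVneq a 0.
    by rewrite scale0r normr0 mulr_ge0.
  rewrite -[k](scalerKV a0) -scalerBr !normrZ mulrCA ler_wpM2l //.
  by apply: uK; exact: closed_subspaceZ.
have [[b b0 Pb]|[l [w [p [Pw w1 lwp lpT]]]]] :=
    bounded_below_or_approx_eigen T_bounded T_compact P1 PZ.
  have [s [As sy]] := closure_seq (dX _ Xy).
  have /choice[w wP] : forall n, exists w, P lambda w /\ A w = s n.
    (* Subtracting from a preimage [v] a nearly best approximation in [K] leaves [A v] unchanged and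
       makes the preimage almost shortest. *)
    move=> n; have [v Xv <-] := As n.
    have [m [Xm Am] mK] := near_best_approx v sK.
    exists (v - m); split; last first.
      by rewrite -scaleN1r addrC A_lin [A m]Am scaler0 add0r.
    split=> //; first exact: closed_subspaceB.
    move=> k Kk; rewrite -addrA -opprD; apply: mK.
    exact: closed_subspaceD.
  have [|M [_ sM]] := cvg_seq_bounded (a := s); first by apply: cvgP sy.
  have /compact_operator_subseq - /(_ T T_compact)[e [p [e_ge Tp]]] :
      forall n, `|w n| <= b * (M + 1).
    move=> n; have [/Pb + Awn] := wP n.
    move=> /le_trans; apply; rewrite ler_wpM2l // -/(A _) Awn.
    by apply: sM => //; rewrite ltrDl.
  have Awy : A (w (e n)) @[n --> \oo] --> y.
    apply: cvg_eqfun (cvg_comp e _ (cvg_ge_id e_ge) sy) => n /=.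
    by have [_ ->] := wP (e n).
  (* Since [lambda *: w = T w - A w], the convergence of both terms forces that of [w]. *)
  have wq : w (e n) @[n --> \oo] --> lambda^-1 *: (p - y).
    apply: cvg_eqfun (cvgZr (k := lambda^-1) (cvgB Tp Awy)) => n /=.
    by rewrite !fctE /A subKr scalerK.
  exists (lambda^-1 *: (p - y)).
    by apply: closed_subspace_cvg wq => // n; have [[]] := wP (e n).
  exact: cvg_limit_eq (A_cvg wq) Awy.
have le n : l n = lambda by have [] := Pw n.
have wk : w n @[n --> \oo] --> lambda^-1 *: p.
  apply: cvg_eqfun (cvgZr (k := lambda^-1) lwp) => n /=.
  by rewrite le scalerK.
have Kp : K (lambda^-1 *: p).
  split; first by apply: closed_subspace_cvg wk => // n; have [] := Pw n.
  rewrite /= /A linearZ /= scalerA mulrC -scalerA -scalerBr.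
  have -> : T p = lambda *: p.
    apply: cvg_limit_eq lpT _.
    by under eq_fun do rewrite le; exact: cvg_cst.
  by rewrite subrr scaler0.
(* The unit vectors [w n] approach an element of [K], yet by [P] they stay at distance at least 1/2
   from [K]. *)
have [n _ /(_ n (leqnn n)) /=] : \forall n \near \oo, `|lambda^-1 *: p - w n| < 2^-1.
  by move/cvgrPdist_lt : wk; apply; rewrite invr_gt0.
have [_ _ /(_ _ Kp)] := Pw n; rewrite w1 distrC => le1.
by rewrite -[2^-1]mulr1 ltr_pdivlMl // => /(le_lt_trans le1); rewrite ltxx.
Qed.


(** From an eigenvector [u], surjectivity builds [v n] with [iter n A (v n) = u], so the kernels of
    the powers of [A] increase strictly. Riesz's lemma then yields unit vectors whose images under
    [T] are pairwise at least 1/2 apart, against compactness. *)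
Lemma onto_injective :
    (forall y, X y -> exists2 u, X u & T u - lambda *: u = y) ->
  forall u, X u -> T u = lambda *: u -> u = 0.
Proof.
move=> A_onto u Xu Tu; apply: contrapT => /eqP u0.
have /choice[f fP] : forall y, exists u, X y -> X u /\ A u = y.
  move=> y; have [Xy|nXy] := pselect (X y); last by exists 0.
  by have [v Xv Av] := A_onto _ Xy; exists v.
pose v n := iter n f u.
have Xv n : X (v n) by elim: n => //= n IHn; have [] := fP _ IHn.
have Av n : A (v n.+1) = v n by have [] := fP _ (Xv n).
have iAv n : iter n A (v n) = u by elim: n => // n IHn; rewrite iterSr Av.
pose N k := X `&` [set w | iter k A w = 0].
have A0 : A 0 = 0 by rewrite /A linear0 scaler0 subrr.
have N_le j k w : (j <= k)%N -> N j w -> N k w.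
  move=> /subnK <- [Xw jw]; split => //=; rewrite iterD jw.
  by elim: (k - j)%N => //= i ->.
have N_A k w : N k.+1 w -> N k (A w).
  move=> [Xw kw]; split; last by rewrite /= -iterSr.
  by apply: closed_subspaceB => //; [exact: TX | exact: closed_subspaceZ].
have N_T k w : N k w -> N k (T w).
  move=> Nw; rewrite -[T w](subrK (lambda *: w)).
  apply: (closed_subspaceD (iterA_kernel k)).
    by apply: N_A; exact: N_le Nw.
  exact: (closed_subspaceZ _ (iterA_kernel k)).
(* The vector [v n] lies in [N n.+1] because [A u = 0], and outside [N n] because [u != 0]; [w n] is
   its normalised difference from a nearly best approximation in [N n]. *)
have /choice[w wP] : forall n, exists w,
    [/\ N n.+1 w, `|w| = 1 & forall z, N n z -> 1 <= 2 * `|w - z|].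
  move=> n; have [m Nm mN] := near_best_approx (v n) (iterA_kernel n).
  have d0 : 0 < `|v n - m|.
    rewrite normr_gt0; apply/eqP => /subr0_eq vm.
    by move: Nm u0; rewrite -vm => -[_ /=]; rewrite iAv => ->; rewrite eqxx.
  have c0 : 0 <= `|v n - m|^-1 by rewrite invr_ge0.
  exists (`|v n - m|^-1 *: (v n - m)); split.
  - apply: (closed_subspaceZ _ (iterA_kernel n.+1)).
    apply: (closed_subspaceB (iterA_kernel n.+1)); last exact: N_le Nm.
    by split => //=; rewrite iAv /A Tu subrr.
  - by rewrite normrZ ger0_norm // mulVf // gt_eqF.
  move=> z Nz; set c := `|_|^-1.
  have c0' : c != 0 by rewrite invr_eq0 gt_eqF.
  rewrite -[z](scalerKV c0') -scalerBr normrZ (ger0_norm c0) mulrCA.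
  rewrite ler_pdivlMl // mulr1 -addrA -opprD; apply: mN.
  apply: (closed_subspaceD (iterA_kernel n)) => //.
  exact: (closed_subspaceZ _ (iterA_kernel n)).
have [e [p [e_ge Tp]]] : exists (e : nat -> nat) (p : H),
    (forall n, (n <= e n)%N) /\ T (w (e n)) @[n --> \oo] --> p.
  by apply: (compact_operator_subseq T_compact (b := 1)) => n; have [_ ->] := wP n.
have far j k : (j < k)%N -> 1 <= 2 * `|T (w k) - T (w j)|.
  move=> jk; have [Nw _ wN] := wP k; have [Nwj _ _] := wP j.
  (* Both [T (w j)] and [A (w k)] lie in [N k], from which [w k] stays away. *)
  have -> : T (w k) - T (w j) = lambda *: (w k - lambda^-1 *: (T (w j) - A (w k))).
    by rewrite scalerBr scalerKV // /A opprB addrA [lambda *: _ + _]addrC subrK.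
  rewrite normrZ lambda1 mul1r; apply: wN.
  apply: (closed_subspaceZ _ (iterA_kernel k)).
  apply: (closed_subspaceB (iterA_kernel k)); last exact: N_A.
  by apply: N_T; exact: N_le Nwj.
have [n _ /= near_p] : \forall n \near \oo, `|p - T (w (e n))| < 2^-1 / 2.
  by move/cvgrPdist_lt : Tp; apply; rewrite divr_gt0 ?invr_gt0.
have near_n := near_p n (leqnn n).
(* As [e] need not be injective, the second term is taken at [(e n).+1], whose image under [e]
   exceeds [e n]. *)
have near_m := near_p (e n).+1 (leq_trans (e_ge n) (leqnSn _)).
have := far (e n) (e (e n).+1) (e_ge _).
apply/negP; rewrite -real_ltNge ?realM ?normr_real //.
rewrite -ltr_pdivlMl // mulr1 -[_ - _](subrKA p) [2^-1]splitr.
by rewrite (le_lt_trans (ler_normD _ _)) // ltrD // distrC.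
Qed.

End fredholm.

(** * The closed subspace generated by an orbit that comes arbitrarily close to 0 *)

Section cyclic_subspace.
Context {R : realType} {H : hilbertType R} (T : {linear H -> H}) (x : H).
Hypotheses (T_bounded : bounded_operator T) (T_compact : compact_operator T).
Local Notation C := R[i].
Implicit Types (u v : H) (a lambda : C).

Definition cyclic_subspace : set H :=
  [set u | forall N, closed_subspace N -> Orb T x `<=` N -> N u].
Local Notation X := cyclic_subspace.

Lemma cyclic_subspace_closed : closed_subspace X.
Proof.
split => [N [] //|a u v Xu Xv N sN TN|].
  by apply: closed_subspace_lin => //; [exact: Xu | exact: Xv].
rewrite closure_id; apply/seteqP; split=> [|p]; first exact: subset_closure.
move=> /closure_seq[w [Xw wp]] N sN TN.
by apply: closed_subspace_cvg wp => // n; exact: Xw.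
Qed.

Lemma cyclic_subspace_iter n : X (iter n T x).
Proof. by move=> N _; apply; exists n. Qed.

(** If a closed subspace [N] contains the orbit, so does the closed subspace [T @^-1] of [N]. *)
Lemma cyclic_subspace_invariant u : X u -> X (T u).
Proof.
move=> Xu N sN TN; apply: (Xu (T @^-1` N)); first exact: closed_subspace_preimage.
by move=> _ [n _ <-]; apply: TN; exists n.+1.
Qed.

Hypothesis liminf0 : forall d : C, 0 < d -> exists n, `|iter n T x| < d.

Lemma cyclic_dense_range lambda : `|lambda| = 1 ->
  X `<=` closure [set T u - lambda *: u | u in X].
Proof.
move=> lambda1; set B := [set _ | _ in X]; set Y := closure B.
have sX := cyclic_subspace_closed.
have Blin a u v : B u -> B v -> B (a *: u + v).
  move=> [u' Xu <-] [v' Xv <-]; exists (a *: u' + v').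
    exact: (closed_subspace_lin a sX).
  by rewrite linearP scalerDr scalerBr !scalerA mulrC opprD addrACA.
have B0 : B 0.
  by exists 0; [exact: closed_subspace0 | rewrite linear0 scaler0 subrr].
have sY : closed_subspace Y by exact: closed_subspace_closure.
have TY u : Y u -> Y (T u).
  move=> /closure_seq[w [Bw wu]].
  apply: (closed_subspace_cvg sY _ (operator_cvg T_bounded wu)) => n.
  apply: subset_closure; have [v Xv <-] := Bw n.
  exists (T v); first exact: cyclic_subspace_invariant.
  by rewrite linearB [T (_ *: _)]linearZ.
have Yiter n : Y (iter n T x - lambda ^+ n *: x).
  elim: n => [|n IHn]; first by rewrite scale1r subrr; exact: closed_subspace0.
  rewrite -[_ - _](subrKA (lambda *: iter n T x)) exprS -scalerA -scalerBr.
  apply: (closed_subspaceD sY); last exact: (closed_subspaceZ _ sY).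
  by apply: subset_closure; exists (iter n T x) => //; exact: cyclic_subspace_iter.
have lambdaX n : `|lambda ^+ n| = 1 by rewrite normrX lambda1 expr1n.
have Yx : Y x.
  apply: contrapT => nYx; have [_ _ cY] := sY.
  have [d d0 dY] := notin_closed_dist cY nYx.
  have [n] := liminf0 d0; apply/negP; rewrite -real_leNgt ?normr_real ?gtr0_real //.
  have ln0 : lambda ^+ n != 0 by rewrite -normr_gt0 lambdaX.
  (* This element of [Y] is [x - (lambda ^+ n)^-1 *: iter n T x], whose distance to [x] is the norm
     of [iter n T x], chosen smaller than [d]. *)
  have : Y (- (lambda ^+ n)^-1 *: (iter n T x - lambda ^+ n *: x)).
    exact: (closed_subspaceZ _ sY).
  move=> /dY; rewrite scaleNr.
  rewrite opprK scalerBr scalerK // [x + _]addrC subrK normrZ normfV lambdaX invr1.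
  by rewrite mul1r.
(* With [x] in the invariant subspace [Y], the whole orbit is in [Y], and [X] is the smallest such
   closed subspace. *)
by move=> u; apply=> // _ [n _ <-]; elim: n => //= n; exact: TY.
Qed.

Lemma cyclic_no_unimodular_eigenvector lambda u :
  `|lambda| = 1 -> X u -> T u = lambda *: u -> u = 0.
Proof.
move=> lambda1; apply: onto_injective => //.
- exact: cyclic_subspace_closed.
- exact: cyclic_subspace_invariant.
- apply: dense_range_onto => //; first exact: cyclic_subspace_closed.
  exact: cyclic_dense_range.
Qed.

(** Without a uniform bound there are a unit vector [p] in [X] and unimodular [l n] such that
    [l n *: p] tends to [T p]. Then [T p] is itself a unimodular multiple of [p], and such
    eigenvectors have been excluded. *)
Lemma cyclic_bounded_below : exists2 b : C, 0 <= b &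
  forall lambda u, `|lambda| = 1 -> X u -> `|u| <= b * `|T u - lambda *: u|.
Proof.
have sX := cyclic_subspace_closed.
pose P lambda u := `|lambda| = 1 /\ X u.
have P1 l u : P l u -> `|l| = 1 by case.
have PZ l a u : P l u -> P l (a *: u).
  by move=> [l1 Xu]; split => //; exact: (closed_subspaceZ _ sX).
have [[b b0 Pb]|[l [w [p [Pw w1 lwp lpT]]]]] :=
    bounded_below_or_approx_eigen T_bounded T_compact P1 PZ.
  by exists b => // lambda u l1 Xu; exact: Pb.
have l1 n : `|l n| = 1 by have [] := Pw n.
have Xp : X p.
  apply: closed_subspace_cvg lwp => // n; apply: (closed_subspaceZ _ sX).
  by have [] := Pw n.
have unit_lim (v : nat -> H) q : (forall n, `|v n| = 1) ->
    v n @[n --> \oo] --> q -> `|q| = 1.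
  move=> v1 /cvg_norm; under eq_fun do rewrite v1.
  by move=> h; apply/esym; apply: (cvg_unique _ (cvg_cst _) h); exact: norm_hausdorff.
have p1 : `|p| = 1.
  by apply: unit_lim lwp => n; rewrite normrZ l1 w1 mulr1.
(* As [p] is a unit vector, [mu *: p] is the orthogonal projection of [T p] onto the line of [p]. *)
pose mu := inner (T p) p.
have Tp : T p = mu *: p.
  apply/eqP; rewrite -subr_eq0; apply: contrapT => /negP z0.
  set z := T p - mu *: p in z0.
  (* [z] is orthogonal to [p], so by Pythagoras [`|z|] is at most
     [`|T p - l n *: p|], which tends to 0. *)
  have zp : inner z p = 0.
    by rewrite linearBl linearZl_LR /= innerE p1 expr1n mulr1 subrr.
  have [n _ /(_ n (leqnn n)) /=] : \forall n \near \oo, `|T p - l n *: p| < `|z|.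
    by move/cvgrPdist_lt : lpT; apply; rewrite normr_gt0.
  apply/negP; rewrite -real_leNgt ?normr_real // -ler_sqr ?nnegrE //.
  have -> : T p - l n *: p = z + (mu - l n) *: p.
    by rewrite scalerBl addrA subrK.
  have zlp : inner z ((mu - l n) *: p) = 0 by rewrite linearZr_LR /= zp mulr0.
  by rewrite -!innerE (hnormDd zlp) lerDl dnorm_ge0.
have mu1 : `|mu| = 1.
  rewrite -[LHS]mulr1 -[in LHS]p1 -normrZ -Tp.
  by apply: unit_lim lpT => n; rewrite normrZ l1 p1 mulr1.
have p0 := cyclic_no_unimodular_eigenvector mu1 Xp Tp.
by move: p1; rewrite p0 normr0 => /eqP; rewrite eq_sym oner_eq0.
Qed.

End cyclic_subspace.

(** * Roots of unity *)

Lemma prim_root_pow2 (F : numClosedFieldType) k :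
  exists z : F, (2 ^ k.+1).-primitive_root z.
Proof.
(* The order of [z] divides [2 ^ k.+1]; a smaller order would divide [2 ^ k] and give [-1 = 1]. *)
pose z : F := (2 ^ k).-root (-1); have zk : z ^+ (2 ^ k) = -1.
  by rewrite rootCK ?expn_gt0.
exists z; have z1 : z ^+ (2 ^ k.+1) = 1 by rewrite expnSr exprM zk sqrrN expr1n.
have k0 : (0 < 2 ^ k.+1)%N by rewrite expn_gt0.
have [m zm /(dvdn_pfactor _ _ (isT : prime 2))[j]] := prim_order_exists k0 z1.
rewrite leq_eqVlt => /predU1P[-> <- //|jk] mj.
have /eqP : z ^+ (2 ^ k) = 1.
  by apply/eqP; rewrite -(prim_order_dvd zm) mj dvdn_exp2l.
by rewrite zk eq_sym -addr_eq0 -mulr2n pnatr_eq0.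
Qed.

Lemma sum_expr_unity_root (F : fieldType) M (z : F) :
  z ^+ M = 1 -> z != 1 -> \sum_(j < M) z ^+ j = 0.
Proof.
move=> zM z1; apply/(mulfI (_ : z - 1 != 0)); first by rewrite subr_eq0.
by rewrite -subrX1 zM subrr mulr0.
Qed.

(** * Bounding the orbit by Fourier inversion *)

Section orbit.
Context {R : realType} {H : hilbertType R} (T : {linear H -> H}) (x : H).
Local Notation C := R[i].
Implicit Types (u : H) (lambda : C).

(** The sum telescopes: [T - c^-1] maps [c ^+ m.+1 *: iter m T x] to [c ^+ m.+1 *: iter m.+1 T x - c
    ^+ m *: iter m T x]. *)
Lemma geometric_orbit_sum (c : C) N : c != 0 ->
  let y := \sum_(m < N) c ^+ m.+1 *: iter m T x in
  T y - c^-1 *: y = c ^+ N *: iter N T x - x.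
Proof.
move=> c0 /=; elim: N => [|N IHN].
  by rewrite !big_ord0 linear0 scaler0 scale1r !subrr.
rewrite big_ord_recr /= linearD scalerDr opprD addrACA IHN.
rewrite [T (_ *: _)]linearZ /= [c^-1 *: _]scalerA exprS mulKf //.
by rewrite addrC subrKA.
Qed.

(** In the polynomial [y c], the coefficient of [c ^+ n.+1] is [iter n T x]. Averaging over the
    [M]-th roots of unity recovers it, so it inherits the bound on [y] over the unit circle. *)
Lemma orbit_bound (b : C) n N :
    (forall lambda u, `|lambda| = 1 -> cyclic_subspace T x u ->
       `|u| <= b * `|T u - lambda *: u|) ->
  0 <= b -> (n < N)%N -> `|iter n T x| <= b * (`|x| + `|iter N T x|).
Proof.
move=> Tb b0 nN; have [z] := prim_root_pow2 R[i] N; set M := (2 ^ _)%N => zM.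
have NM : (N < M)%N by rewrite (leq_trans _ (ltnW (ltn_expl _ _))).
have sX := @cyclic_subspace_closed R H T x.
pose y c := \sum_(m < N) c ^+ m.+1 *: iter m T x.
have y_bound c : `|c| = 1 -> `|y c| <= b * (`|x| + `|iter N T x|).
  move=> c1; have c0 : c != 0 by rewrite -normr_gt0 c1.
  have c1' : `|c^-1| = 1 by rewrite normfV c1 invr1.
  apply: le_trans (Tb _ _ c1' _) _.
    apply: (closed_subspace_sum sX) => m; apply: (closed_subspaceZ _ sX).
    exact: cyclic_subspace_iter.
  rewrite geometric_orbit_sum // ler_wpM2l // [leRHS]addrC.
  by rewrite (le_trans (ler_normB _ _)) // normrZ normrX c1 expr1n mul1r.
have z1 : `|z| = 1.
  apply/eqP; rewrite -(@pexpr_eq1 _ _ M) ?expn_gt0 // -normrX.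
  by rewrite prim_expr_order // normr1.
have zj1 j k : `|(z ^+ j) ^+ k| = 1 by rewrite !normrX z1 !expr1n.
(* The exponent [M - n.+1] stands for [- n.+1], as [z ^+ M = 1]. *)
have inversion : \sum_(j < M) (z ^+ j) ^+ (M - n.+1) *: y (z ^+ j) =
    M%:R *: iter n T x.
  under eq_bigr => j _.
    rewrite scaler_sumr; under eq_bigr do rewrite scalerA -exprD exprAC.
    over.
  rewrite exchange_big /=; under eq_bigr do rewrite -scaler_suml.
  rewrite (bigD1 (Ordinal nN)) //= [X in _ + X]big1 ?addr0 => [|m mn].
    rewrite subnK ?(leq_trans nN) 1?ltnW // (prim_expr_order zM).
    by under eq_bigr do rewrite expr1n; rewrite sumr_const card_ord.
  rewrite sum_expr_unity_root ?scale0r //.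
    by rewrite exprAC (prim_expr_order zM) expr1n.
  rewrite -(prim_order_dvd zM).
  (* The total exponent [M - n.+1 + m.+1] lies strictly between 0 and [2 * M] because [m < N < M],
     and it equals [M] only for [m = n]. *)
  move: mn (ltn_ord m); rewrite -val_eqE /= => /eqP mn mN.
  by apply/negP => /dvdnP[[|[|q]]]; rewrite ?mulSn => eqM; lia.
rewrite -(ler_pM2l (_ : 0 < M%:R)) ?ltr0n ?expn_gt0 //.
rewrite -[M%:R * `|_|](_ : `|M%:R *: iter n T x| = _); last first.
  by rewrite normrZ ger0_norm.
rewrite -inversion (le_trans (ler_norm_sum _ _ _)) //.
rewrite mulr_natl -[M in leRHS]card_ord -sumr_const ler_sum // => j _.
by rewrite normrZ zj1 mul1r y_bound // normrX z1 expr1n.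
Qed.

End orbit.

(** * The orbit would be both bounded and unbounded *)

Theorem theorem4p11 (R : realType) (H : hilbertType R) (Hsep : separable H)
    (T : {linear H -> H}) (Tbounded : bounded_operator T)
    (Tcompact : compact_operator T) (M : set H) (Msub : closed_subspace M)
    (Mneq0 : M <> [set 0]) :
  ~ subspace_hypercyclic T M.
Proof.
move=> [x Mx]; have M0 := closed_subspace0 Msub.
have [s [sO s0]] := closure_seq (Mx _ M0).
have cvg_iter n : iter n T (s k) @[k --> \oo] --> (0 : H).
  elim: n => [|n IHn] //; rewrite -(linear0 T).
  exact: (operator_cvg Tbounded IHn).
(* Applying [iter n T] to orbit points that tend to 0 gives small orbit points at times at least
   [n]. *)
have near_iter n d : 0 < d -> exists m, `|iter (n + m) T x| < d.
  move=> d0; have [k _ /(_ k (leqnn k)) /=] : \forall k \near \oo,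
      `|0 - iter n T (s k)| < d by move/cvgrPdist_lt : (cvg_iter n); exact.
  have [[m _ <-] _] := sO k; rewrite sub0r normrN -iterD => lt_d.
  by exists m.
have [b b0 Tb] := cyclic_bounded_below Tbounded Tcompact (near_iter 0%N).
have orb_le n : `|iter n T x| <= b * (`|x| + 1).
  (* The time [n.+1 + m] is strictly later than [n], as [orbit_bound] demands. *)
  have [m lt1] := near_iter n.+1 1 ltr01.
  apply: le_trans (orbit_bound Tb b0 (leq_addr m n.+1)) _.
  by rewrite ler_wpM2l // lerD2l ltW.
set K := b * _ in orb_le.
have [w Mw w0] : exists2 w, M w & w != 0.
  apply: contrapT => nw; apply: Mneq0; apply/seteqP; split=> [w Mw|_ -> //].
  by apply: contrapT => w0; apply: nw; exists w => //; exact/eqP.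
have K0 : 0 <= K by exact: le_trans (orb_le 0%N).
(* A vector of [M] with norm [K + 1]: an orbit point at distance less than 1 from it would have norm
   above [K]. *)
pose v := ((K + 1) / `|w|) *: w.
have vK : `|v| = K + 1.
  by rewrite normrZ normf_div normr_id ger0_norm ?addr_ge0 // divfK ?normr_eq0.
have [t [tO tv]] := closure_seq (Mx _ (closed_subspaceZ ((K + 1) / `|w|) Msub Mw)).
have [k _ /(_ k (leqnn k)) /=] : \forall k \near \oo, `|v - t k| < 1.
  by move/cvgrPdist_lt : tv; exact.
have [[m _ <-] _] := tO k; apply/negP.
rewrite -real_leNgt ?normr_real //.
apply: le_trans (lerB_dist _ _); rewrite vK lerBrDl lerD2r.
exact: orb_le.
Qed.
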